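(* There exists a constant $\varepsilon > 0$ such that $$R(k) \le (4 - \varepsilon)^k$$ for all sufficiently large $k \in \mathbb{N}$.
   Context: The Ramsey number $R(k)$ is the minimum $n \in \mathbb{N}$ such that every red-blue colouring of the edges of the complete graph $K_n$ on $n$ vertices contains a monochromatic copy of $K_k$. *)

(* Defs.v *)
From mathcomp Require Import all_boot.

Set Implicit Arguments.
Unset Strict Implicit.
Unset Printing Implicit Defensive.

Definition edge (n : nat) := {e : {set 'I_n} | #|e| == 2}.

(* true is red and false is blue. *)
Definition colouring (n : nat) := {ffun edge n -> bool}.

Definition monochromatic (n : nat) (f : colouring n) (S : {set 'I_n}) : bool :=
  [exists c : bool, [forall e : edge n, (val e \subset S) ==> (f e == c)]].

Definition forces_clique (k n : nat) : bool :=
  [forall f : colouring n,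
     [exists S : {set 'I_n}, (#|S| == k) && monochromatic f S]].

(* Finite Ramsey theorem, needed to know that the minimum defining [ramsey]
   exists. *)
Lemma ramsey_rel (T : finType) (r : rel T) (a b : nat) (A : {set T}) :
  symmetric r -> 2 ^ (a + b) <= #|A| ->
  exists2 S : {set T}, S \subset A &
    (#|S| = a /\ {in S &, forall x y, x != y -> r x y}) \/
    (#|S| = b /\ {in S &, forall x y, x != y -> ~~ r x y}).
Proof.
move=> symr; have [m] := ubnP (a + b).
elim: m a b A => // m IHm [|a] [|b] A lem leA;
  try by exists set0; rewrite ?sub0set ?cards0 //;
    first [left; split=> // x y; rewrite inE | right; split=> // x y; rewrite inE].
have /card_gt0P[x Ax] : 0 < #|A| by apply: leq_trans leA; rewrite expn_gt0.
pose N := [set y in A :\ x | r x y]; pose M := [set y in A :\ x | ~~ r x y].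
have sNA : N \subset A by apply/subsetP=> y; rewrite !inE => /andP[/andP[]].
have sMA : M \subset A by apply/subsetP=> y; rewrite !inE => /andP[/andP[]].
have cardA : #|A| = (#|N| + #|M|).+1.
  rewrite (cardsD1 x A) Ax -(cardsID [set y | r x y] (A :\ x)); congr (_ + _).+1.
    by apply: eq_card => y; rewrite !inE.
  by apply: eq_card => y; rewrite !inE andbC.
have /orP[leN|leM] : (2 ^ (a + b.+1) <= #|N|) || (2 ^ (a.+1 + b) <= #|M|).
  rewrite addSnnS; set X := 2 ^ (a + b.+1).
  apply: contraTT leA; rewrite negb_or -!ltnNge => /andP[ltN ltM].
  rewrite addSn expnS mul2n -addnn cardA -addnS -addSn.
  exact: leq_add.
- have [||S sSN [[cS rS]|[cS rS]]] := IHm a b.+1 N.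
  + by rewrite addSn ltnS in lem.
  + exact: leN.
  + have xS : x \notin S by apply/negP=> /(subsetP sSN); rewrite !inE eqxx.
    exists (x |: S); first by rewrite subUset sub1set Ax (subset_trans sSN).
    left; split; first by rewrite cardsU1 xS cS.
    move=> y z; rewrite !inE => /orP[/eqP->|Sy] /orP[/eqP->|Sz]; rewrite ?eqxx //.
    * by move=> _; have := subsetP sSN z Sz; rewrite !inE => /andP[].
    * by move=> _; rewrite symr; have := subsetP sSN y Sy; rewrite !inE => /andP[].
    * exact: rS.
  + by exists S; [apply: subset_trans sNA | right].
- have [||S sSM [[cS rS]|[cS rS]]] := IHm a.+1 b M.
  + by rewrite addnS ltnS in lem.
  + exact: leM.
  + by exists S; [apply: subset_trans sMA | left].
  + have xS : x \notin S by apply/negP=> /(subsetP sSM); rewrite !inE eqxx.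
    exists (x |: S); first by rewrite subUset sub1set Ax (subset_trans sSM).
    right; split; first by rewrite cardsU1 xS cS.
    move=> y z; rewrite !inE => /orP[/eqP->|Sy] /orP[/eqP->|Sz]; rewrite ?eqxx //.
    * by move=> _; have := subsetP sSM z Sz; rewrite !inE => /andP[].
    * by move=> _; rewrite symr; have := subsetP sSM y Sy; rewrite !inE => /andP[].
    * exact: rS.
Qed.

Lemma ramsey_exists (k : nat) : exists n, forces_clique k n.
Proof.
exists (2 ^ (k + k)); apply/forallP=> f.
pose r x y := if insub [set x; y] is Some e then f e else false.
have symr : symmetric r by move=> x y; rewrite /r setUC.
have [|S _ HS] := @ramsey_rel _ r k k setT symr; first by rewrite cardsT card_ord.
have rE (e : edge _) x y : val e = [set x; y] -> r x y = f e.
  by rewrite /r => <-; rewrite valK.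
apply/existsP; exists S; case: HS => -[-> rS]; rewrite eqxx /=; apply/existsP;
  [exists true | exists false]; apply/forallP=> e; apply/implyP;
  have /cards2P[x [y [nxy eE]]] := valP e; rewrite eE subUset !sub1set => /andP[Sx Sy];
  have := rS x y Sx Sy nxy; rewrite (rE e) //; by case: (f e).
Qed.

Definition ramsey (k : nat) : nat := ex_minn (ramsey_exists k).

(* Main.v *)
Require Import Defs.
From mathcomp Require Import all_boot all_order all_algebra.
From mathcomp Require Import reals sequences exp.
From mathcomp Require Import ring lra.

Set Implicit Arguments.
Unset Strict Implicit.
Unset Printing Implicit Defensive.

Import Order.TTheory GRing.Theory Num.Theory.
Local Open Scope ring_scope.

(** The Erdos-Szekeres argument gives R(k) <= 4^k: every vertex put into one of
the two growing cliques halves the set of candidates. To do better one looks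
for a book, a monochromatic clique S of size t all of whose vertices are joined
in the same colour to a set W of pages, with W not much smaller than 4^k 2^-t.
Inside W the target is unbalanced, k - t in the colour of the book against k in
the other one, and the weighted form of the Erdos-Szekeres bound
([erdos_szekeres], with weights (1 - eta)/2 and (1 + eta)/2 for the two colours)
then saves a factor exp(c t^2 / k) over 2^(2k - t) ([unbalanced_bound]). With t
proportional to k this is an exponential saving, provided that finding the book
costs less.

Books are found by an algorithm that keeps a reservoir X and, for each colour
c, a set Y c of pages such that every vertex of X has density at least p c to
Y c in colour c ([monochromatic_book]). Passing to the neighbourhood of a vertex
x of X in Y c multiplies Y c by its density, and keeps the density if X is
restricted to the vertices y whose neighbourhoods correlate with that of x.
Correlations are inner products, so positive semidefinite kernels in (x, y).
For two such kernels, [correlated_star] shows that some x has a set of partners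
y for which neither correlation is very negative, and that, if this set is a
small part of X, then one of the two correlations is in return large: a level
j^2 of correlation costs only a factor exp(9 (j + 1)) of X. This comes from
summing over all pairs (x, y) a polynomial with nonnegative coefficients in the
two kernels; such a sum is nonnegative, while the polynomial is negative whenever
one kernel is very negative, and at most exp(O(sqrt z)) at height z.

If j is below a threshold mu, the vertex x joins the book of its majority
colour among the partners ([colour_step]). Otherwise the pages are replaced
without enlarging the book ([boost_step]), but the density grows by a factor
1 + j^2 / 3t or so. As densities are at most 1, there are at most
O(t log mu / mu^2) such steps. So the pages lose a factor 2^t times
exp(O(t log mu / mu^2)), and the reservoir exp(O(mu t)), which is affordable for
t of order k / mu. The saving is then exp(c t / mu), and it beats the loss
once mu is large.

The algorithm needs all degrees in both colours to be at least (1/2 - eps) of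
the vertex set ([clique_in_regular]). If a vertex violates this, then an
Erdos-Szekeres step into its other colour keeps a proportion larger than
(1 + eps)/2; a linear number of such steps is already an exponential saving
([clique_by_steps]). *)

(** * Positive semidefinite kernels *)

Section GramKernels.
Variables (R : realType) (V : finType).
Implicit Types K L : V -> V -> R.

(** Positive semidefinite kernels, given through a finite factorization: this
makes closure under products evident, by taking products of feature maps. *)
Definition gram K := exists (I : finType) (u : I -> V -> R),
  forall x y, K x y = \sum_i u i x * u i y.

Lemma gram_ext K L : gram K -> K =2 L -> gram L.
Proof. by move=> [I [u uE]] KL; exists I, u => x y; rewrite -KL. Qed.

Lemma gramD K L : gram K -> gram L -> gram (fun x y => K x y + L x y).
Proof.
move=> [I [u uE]] [J [v vE]].
exists (I + J)%type, (fun s => match s with inl i => u i | inr j => v j end).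
by move=> x y; rewrite big_sumType /= uE vE.
Qed.

Lemma gramM K L : gram K -> gram L -> gram (fun x y => K x y * L x y).
Proof.
move=> [I [u uE]] [J [v vE]].
exists (I * J)%type, (fun s x => u s.1 x * v s.2 x) => x y.
rewrite uE vE big_distrlr /= pair_big /=.
by apply: eq_bigr => -[i j] _ /=; ring.
Qed.

Lemma gram_cst c : 0 <= c -> gram (fun _ _ => c).
Proof.
move=> c0; exists unit, (fun _ _ => Num.sqrt c) => x y.
by rewrite big_const card_unit /= addr0 -expr2 sqr_sqrtr.
Qed.

(** With K x y = sum_i u i x * u i y, the double sum is a sum of squares. *)
Lemma gram_sum_ge0 K (X : {set V}) : gram K ->
  0 <= \sum_(x in X) \sum_(y in X) K x y.
Proof.
move=> [I [u uE]].
have -> : \sum_(x in X) \sum_(y in X) K x y = \sum_i (\sum_(x in X) u i x) ^+ 2.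
  under eq_bigr => x _ do under eq_bigr => y _ do rewrite uE.
  under eq_bigr => x _ do rewrite exchange_big.
  rewrite exchange_big; apply: eq_bigr => i _.
  by rewrite expr2 big_distrlr.
by apply: sumr_ge0 => i _; apply: sqr_ge0.
Qed.

End GramKernels.

(** * Chebyshev polynomials *)

Section Chebyshev.
Variable R : realType.
Implicit Types x y s : R.

(** For the Chebyshev polynomials T_n, this is the pair
(T_(n+1) (1 + y), T_(n+1) (1 + y) - T_n (1 + y)). The recurrence
T_(n+2) - T_(n+1) = (T_(n+1) - T_n) + 2 y T_(n+1) involves no subtraction, so that
all the coefficients in y are nonnegative. *)
Fixpoint cheb (n : nat) y : R * R :=
  if n is n'.+1 then
    let: (T, D) := cheb n' y in (T + (D + 2 * y * T), D + 2 * y * T)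
  else (1 + y, y).

Lemma gram_cheb (V : finType) (K : V -> V -> R) n : gram K ->
  gram (fun v w => (cheb n (K v w)).1) /\ gram (fun v w => (cheb n (K v w)).2).
Proof.
move=> gK; elim: n => [|n [gT gD]] /=.
  by split=> //; apply: gramD => //; apply: gram_cst.
have gD' : gram (fun v w => (cheb n (K v w)).2 + 2 * K v w * (cheb n (K v w)).1).
  by apply: gramD => //; apply: gramM => //; apply: gramM => //; apply: gram_cst.
split; last by apply: gram_ext gD' _ => v w; case: (cheb n _).
by apply: gram_ext (gramD gT gD') _ => v w; case: (cheb n _).
Qed.

Lemma cheb_ge n y : 0 <= y -> 1 + n.+1%:R ^+ 2 * y <= (cheb n y).1.
Proof.
move=> y0.
suff [] : 1 + n.+1%:R ^+ 2 * y <= (cheb n y).1 /\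
          (2 * n%:R + 1) * y <= (cheb n y).2 by [].
elim: n => [|n] /=; first by split; lra.
case: (cheb n y) => T D /= [hT hD].
have T1 : 1 <= T.
  by apply: le_trans hT; rewrite lerDl mulr_ge0 // exprn_ge0.
have hyT : y <= y * T by rewrite ler_peMr.
have hD' : (2 * n.+1%:R + 1) * y <= D + 2 * y * T.
  by rewrite -(natr1 n); lra.
split=> //; rewrite -(natr1 n.+1) -(natr1 n) in hT hD' *; lra.
Qed.

Lemma cheb_le n y s : 0 <= y -> 0 <= s -> 2 * y <= s ^+ 2 ->
  (cheb n y).1 <= (1 + s) ^+ (2 * n.+1).
Proof.
move=> y0 s0 ys; rewrite exprM.
have A1 : 1 + s + s ^+ 2 <= (1 + s) ^+ 2 by nra.
have s2 := sqr_ge0 s.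
suff [] : (cheb n y).1 <= ((1 + s) ^+ 2) ^+ n.+1 /\
          (cheb n y).2 <= s * ((1 + s) ^+ 2) ^+ n.+1 by [].
elim: n => [|n] /=; first by rewrite expr1; split; nra.
case: (cheb n y) => T D /=; rewrite [_ ^+ n.+2]exprS.
have P0 : 0 <= ((1 + s) ^+ 2) ^+ n.+1 by rewrite !exprn_ge0 // addr_ge0.
move: (((1 + s) ^+ 2) ^+ n.+1) P0 => P P0 [hT hD].
have h1 : 2 * y * T <= s ^+ 2 * P.
  apply: (@le_trans _ _ (2 * y * P)); last exact: ler_wpM2r.
  by apply: ler_wpM2l => //; apply: mulr_ge0.
have h2 : D + 2 * y * T <= s * (1 + s) * P by lra.
have h3 : (1 + s + s ^+ 2) * P <= (1 + s) ^+ 2 * P by exact: ler_wpM2r.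
split; first by lra.
apply: le_trans h2 _; rewrite -!mulrA; apply: ler_wpM2l => //.
by rewrite mulrA; apply: ler_wpM2r => //; lra.
Qed.

(** With 1 + y = cos x, the identity E in the proof is the identity
sin(x)^2 sin(n x)^2 + sin(x)^2 cos(n x)^2 = sin(x)^2. *)
Lemma cheb_abs n y : -1 <= y <= 0 -> -1 <= (cheb n y).1 <= 1.
Proof.
move=> /andP[y1 y0].
have [->|yn0] := eqVneq y 0.
  have h1 := @cheb_ge n 0 (lexx _); have h2 := @cheb_le n 0 0 (lexx _) (lexx _).
  rewrite addr0 expr1n in h2; apply/andP; split; last by apply: h2; lra.
  by apply: le_trans h1; lra.
have {yn0} y0' : y < 0 by rewrite lt_neqAle yn0.
have E : ((cheb n y).2 + y * (cheb n y).1) ^+ 2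
           + (- 2 * y - y ^+ 2) * (cheb n y).1 ^+ 2 = - 2 * y - y ^+ 2.
  elim: n => [|n] /=; first by ring.
  by case: (cheb n y) => T D /= H; rewrite -[RHS]H; ring.
set T := (cheb n y).1 in E *.
have c0 : 0 < - 2 * y - y ^+ 2 by nra.
have : (- 2 * y - y ^+ 2) * T ^+ 2 <= (- 2 * y - y ^+ 2) * 1.
  by rewrite mulr1 -{2}E lerDr sqr_ge0.
by rewrite ler_pM2l // => hT; apply/andP; split; nra.
Qed.

End Chebyshev.

(** * Correlated pairs for two kernels *)

Section Geometric.
Variables (R : realType) (V : finType).

(** A polynomial substitute for cosh (sqrt (2 x)): on the positive side it grows
like an exponential of the square root, on the negative side it oscillates in
[-1, 1] like a cosine, and it has nonnegative coefficients. It is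
T_d (1 + x / d^2), with d so large that x >= - M stays in the range of
oscillation. *)
Lemma cosh_like (M : R) : exists h : R -> R,
  [/\ forall K : V -> V -> R, gram K -> gram (fun v w => h (K v w)),
      forall x, - M <= x <= 0 -> - 1 <= h x <= 1,
      forall x, 0 <= x -> 1 + x <= h x &
      forall x (n : nat), 0 <= x <= n%:R ^+ 2 -> h x <= expR (4 * n%:R)].
Proof.
have M0 : 0 <= `|M| by [].
pose m := Num.bound `|M|; have Mm := archi_boundP M0; rewrite -/m in Mm.
pose d : R := m.+1%:R; have d1 : 1 <= d by rewrite ler1n.
have d0 : 0 < d by lra.
have d2 : 0 < d ^+ 2 by rewrite exprn_gt0.
have Md : M <= d ^+ 2.
  have := ler_norm M; have : m%:R < d by rewrite ltr_nat.
  by move=> ? ?; nra.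
exists (fun x => (cheb m (x / d ^+ 2)).1); split.
- move=> K gK; have gK' : gram (fun v w => K v w / d ^+ 2).
    apply: (@gramM _ _ K (fun _ _ => (d ^+ 2)^-1)) => //.
    by apply: gram_cst; rewrite invr_ge0 ltW.
  by have [] := gram_cheb m gK'.
- move=> x /andP[x1 x0]; apply: cheb_abs.
  rewrite ler_pdivlMr // ler_pdivrMr // mul0r x0 andbT.
  by rewrite mulN1r; lra.
- move=> x x0; apply: le_trans (cheb_ge m _); last first.
    by rewrite divr_ge0 // ltW.
  by rewrite -/d mulrC divfK ?gt_eqF.
- move=> x n /andP[x0 xn].
  have s0 : 0 <= 2 * n%:R / d by rewrite divr_ge0 ?mulr_ge0 // ltW.
  apply: le_trans (@cheb_le R m (x / d ^+ 2) (2 * n%:R / d) _ s0 _) _.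
  + by rewrite divr_ge0 // ltW.
  + rewrite expr_div_n mulrA ler_pdivrMr // divfK ?gt_eqF // exprMn; nra.
  + have -> : 4 * n%:R = (2 * m.+1)%:R * (2 * n%:R / d) :> R.
      by rewrite natrM -/d; field; rewrite gt_eqF.
    rewrite expRM_natl lerXn2r ?nnegrE ?expR_ge0 ?expR_ge1Dx //.
    by rewrite addr_ge0.
Qed.

(** Level j means that coordinate c is at least j^2 - 3, and that the other one
is at least -3. The squares make the level equal to the square root of the
height, which is what the growth of [cosh_like] is measured by. *)
Definition level_pair (z : bool -> R) (c : bool) (j : nat) : bool :=
  (j%:R ^+ 2 - 3 <= z c) && (- 3 <= z (~~ c)).

(** A bound for the test function below, plus 3, when the larger coordinate is less
than (j + 1)^2; the power of 4 dominates that square. *)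
Let weight (j : nat) : R := 9 * 4 ^+ j * expR (4 * j.+1%:R).

Lemma exists_level (z : R) (J : nat) : - 3 <= z -> z < J%:R ^+ 2 - 3 ->
  exists2 j, (j < J)%N & j%:R ^+ 2 - 3 <= z < j.+1%:R ^+ 2 - 3.
Proof.
move=> z3; elim: J => [|J IH] zJ; first by rewrite expr0n /= in zJ; lra.
have [zJ'|Jz] := ltP z (J%:R ^+ 2 - 3); last by exists J; rewrite ?Jz ?zJ.
by have [j jJ jz] := IH zJ'; exists j => //; apply: ltnW.
Qed.

(** The test function z_t (2 + h z_f) + z_f (2 + h z_t) is at most -3 as soon as one
coordinate is below -3. If the other coordinate is negative too, then the term
with the former as a factor is at most -3, and the other one is nonpositive; if it
is z > 0, then the first term is at most -3 (3 + z), which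
outweighs the second, at most 3 z. Elsewhere the function is at most the weight
of the level of the larger coordinate. *)
Lemma test_function_le (M : R) (h : R -> R) (J : nat) (z : bool -> R) :
  (forall x, - M <= x <= 0 -> - 1 <= h x <= 1) ->
  (forall x, 0 <= x -> 1 + x <= h x) ->
  (forall x (n : nat), 0 <= x <= n%:R ^+ 2 -> h x <= expR (4 * n%:R)) ->
  (forall c, `|z c| <= M) -> M < J%:R ^+ 2 - 3 ->
  z true * (2 + h (z false)) + z false * (2 + h (z true)) <=
    - 3 + \sum_(j < J) \sum_c (level_pair z c j)%:R * weight j.
Proof.
move=> hneg hpos hup zM MJ.
have w0 j : 0 <= weight j by rewrite !mulr_ge0 ?exprn_ge0 ?expR_ge0.
have [zlo zhi] : (forall c, - M <= z c) /\ (forall c, z c <= M).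
  by split=> c; have := zM c; rewrite ler_norml => /andP[].
have h1 c : - 1 <= h (z c).
  have [z0|z0] := leP (z c) 0; first by have /andP[] := hneg (z c) (introT andP (conj (zlo c) z0)).
  by have := hpos _ (ltW z0); lra.
pose f c := z c * (2 + h (z (~~ c))) + z (~~ c) * (2 + h (z c)).
have fE c : z true * (2 + h (z false)) + z false * (2 + h (z true)) = f c.
  by case: c; rewrite /f //= addrC.
have s0 : 0 <= \sum_(j < J) \sum_c (level_pair z c j)%:R * weight j.
  by apply: sumr_ge0 => j _; apply: sumr_ge0 => c _; rewrite mulr_ge0.
have fneg c : z c < - 3 -> f c <= - 3.
  move=> zc; rewrite /f; have hc := h1 (~~ c).
  have zc0 : z c <= 0 by lra.
  have /andP[k1 k2] := hneg (z c) (introT andP (conj (zlo c) zc0)).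
  have [z0|z0] := leP (z (~~ c)) 0; first by nra.
  by have := hpos _ (ltW z0); nra.
have [zt|zt] := ltP (z true) (- 3); first by rewrite (fE true); have := fneg _ zt; lra.
have [zf|zf] := ltP (z false) (- 3); first by rewrite (fE false); have := fneg _ zf; lra.
have [c zc] : exists c, z (~~ c) <= z c.
  by have [le|lt] := leP (z true) (z false); [exists false | exists true; apply: ltW].
have z3 b : - 3 <= z b by case: b.
have [j jJ /andP[zj1 zj2]] := exists_level (z3 c) (le_lt_trans (zhi c) MJ).
have fw : f c <= - 3 + weight j.
  have n0 : 0 <= j%:R :> R by [].
  have E1 : 1 <= expR (4 * j.+1%:R) :> R by have := expR_ge1Dx (4 * j.+1%:R : R); rewrite -natr1; lra.
  have hE b : z b <= z c -> h (z b) <= expR (4 * j.+1%:R).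
    move=> zb; have [z0|z0] := leP (z b) 0.
      by have /andP[] := hneg (z b) (introT andP (conj (zlo b) z0)); lra.
    by apply: hup; rewrite (ltW z0) /=; lra.
  have key b b' : z b <= z c -> z b' <= z c ->
      z b * (2 + h (z b')) <= j.+1%:R ^+ 2 * (3 * expR (4 * j.+1%:R)).
    move=> zb zb'; have H0 := h1 b'; have H1 := hE b' zb'.
    have S0 : 0 <= j.+1%:R ^+ 2 :> R by rewrite sqr_ge0.
    apply: (@le_trans _ _ (j.+1%:R ^+ 2 * (2 + h (z b')))).
      by apply: ler_wpM2r; lra.
    by apply: ler_wpM2l => //; lra.
  have := key c (~~ c) (lexx _) zc; have := key (~~ c) c zc (lexx _).
  have : j.+1%:R ^+ 2 <= 4 ^+ j :> R.
    rewrite -natrX -(natrX _ 4) ler_nat -[4%N]/(2 ^ 2)%N -expnM mulnC expnM leq_exp2r //.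
    exact: ltn_expl.
  have : 1 <= 4 ^+ j :> R by rewrite exprn_ege1 //; lra.
  rewrite /f /weight; move: (expR _) E1 => E E1; move: (4 ^+ j) (j.+1%:R ^+ 2) => Q S *; nra.
rewrite (fE c); apply: le_trans fw _; rewrite lerD2l.
rewrite (bigD1 (Ordinal jJ)) //= (bigD1 c) //= /level_pair zj1 z3 mul1r -addrA lerDl.
apply: addr_ge0; apply: sumr_ge0 => *; first by rewrite mulr_ge0.
by apply: sumr_ge0 => *; rewrite mulr_ge0.
Qed.

(** The decay exp (-9 (j + 1)) of the stars is chosen to make the level weights
summable. *)
Lemma weight_sum_le (J : nat) :
  \sum_(j < J) weight j * expR (- 9 * j.+1%:R) <= 1.
Proof.
have e2 : 2 <= expR 1 :> R by have := expR_ge1Dx (1 : R); lra.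
have wj j : weight j * expR (- 9 * j.+1%:R) <= 2^-1 ^+ j.+1.
  have -> : weight j * expR (- 9 * j.+1%:R) = 9 * 4 ^+ j / expR 1 ^+ (5 * j.+1).
    rewrite -expRM_natl -expRN /weight -mulrA -expRD mulr1; congr (_ * expR _).
    by rewrite natrM; ring.
  rewrite ler_pdivrMr ?exprn_gt0 ?expR_gt0 //.
  apply: (@le_trans _ _ (2^-1 ^+ j.+1 * 2 ^+ (5 * j.+1))); last first.
    by apply: ler_wpM2l; [rewrite exprn_ge0 // invr_ge0 | rewrite lerXn2r ?nnegrE ?expR_ge0].
  rewrite exprM -exprMn.
  have -> : 2^-1 * 2 ^+ 5 = 16 :> R by field.
  rewrite exprS; have -> : 9 * 4 ^+ j <= 16 * 16 ^+ j :> R; last by [].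
  have : 4 ^+ j <= 16 ^+ j :> R by rewrite lerXn2r ?nnegrE //; lra.
  have : 0 <= 4 ^+ j :> R by rewrite exprn_ge0.
  by lra.
apply: (@le_trans _ _ (\sum_(j < J) 2^-1 ^+ j.+1)); first by apply: ler_sum => j _; apply: wj.
suff : \sum_(j < J) 2^-1 ^+ j.+1 <= 1 - 2^-1 ^+ J :> R.
  by have P0 : 0 <= 2^-1 ^+ J :> R; [rewrite exprn_ge0 // invr_ge0 | lra].
elim: J => [|J IH]; first by rewrite big_ord0 subrr.
by rewrite big_ord_recr /= exprS; lra.
Qed.

(** If every star were smaller than claimed at every level, then the sum over
X x X of the test function, which is nonnegative because the function is a
polynomial with nonnegative coefficients in positive semidefinite kernels,
would be at most -3 #|X|^2 + 2 #|X|^2. *)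
Lemma correlated_star (Z : bool -> V -> V -> R) (X : {set V}) :
  (forall c, gram (Z c)) -> X != set0 ->
  exists (c : bool) (j : nat), exists2 x, x \in X &
    expR (- 9 * j.+1%:R) * #|X|%:R <=
      #|[set y in X | level_pair (fun b => Z b x y) c j]|%:R :> R.
Proof.
move=> gZ X0.
pose M : R := \sum_v \sum_w (`|Z true v w| + `|Z false v w|).
have ZM c v w : `|Z c v w| <= M.
  apply: (@le_trans _ _ (`|Z true v w| + `|Z false v w|)).
    by case: c; rewrite ?lerDl ?lerDr.
  rewrite /M (bigD1 v) //= (bigD1 w) //= -addrA lerDl.
  by apply: addr_ge0; apply: sumr_ge0 => *; [|apply: sumr_ge0 => *]; rewrite addr_ge0.
have M0 : 0 <= M by apply: sumr_ge0 => *; apply: sumr_ge0 => *; rewrite addr_ge0.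
(* No kernel value reaches level J, so that finitely many levels suffice. *)
pose J := (Num.bound M).+3.
have MJ : M < J%:R ^+ 2 - 3.
  have := archi_boundP M0; rewrite /J -!(natr1 _.+1) -natr1.
  have : 0 <= (Num.bound M)%:R :> R by [].
  by move=> ? ?; nra.
have [h [hgram hneg hpos hup]] := cosh_like M.
have [/existsP[[[c j] x] /= /andP[xX H]]|] := boolP [exists p : bool * 'I_J * V,
    (p.2 \in X) && (expR (- 9 * p.1.2.+1%:R) * #|X|%:R <=
      #|[set y in X | level_pair (fun b => Z b p.2 y) p.1.1 p.1.2]|%:R :> R)].
  by exists c, (j : nat), x.
move=> /existsPn small; exfalso.
have {}small c (j : 'I_J) x : x \in X ->
    #|[set y in X | level_pair (fun b => Z b x y) c j]|%:R <= expR (- 9 * j.+1%:R) * #|X|%:R :> R.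
  by move=> xX; have := small (c, j, x); rewrite /= xX /= -ltNge => /ltW.
have N0 : 0 < #|X|%:R :> R by rewrite ltr0n card_gt0.
have gF : gram (fun v w => Z true v w * (2 + h (Z false v w)) + Z false v w * (2 + h (Z true v w))).
  have g2h c : gram (fun v w => 2 + h (Z c v w)).
    by apply: gramD; [apply: gram_cst | apply: hgram].
  by apply: gramD; apply: gramM.
have := gram_sum_ge0 X gF; apply/negP; rewrite -ltNge.
apply: le_lt_trans (_ : \sum_(x in X) \sum_(y in X) (- 3 + \sum_(j < J) \sum_c
     (level_pair (fun b => Z b x y) c j)%:R * weight j) < 0).
  apply: ler_sum => x _; apply: ler_sum => y _.
  exact: (@test_function_le M h J (fun b => Z b x y)).
apply: (@le_lt_trans _ _ (\sum_(x in X) (- #|X|%:R))); last first.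
  by rewrite sumr_const -mulNrn -mulr_natr; nra.
apply: ler_sum => x xX; rewrite big_split /= sumr_const exchange_big /=.
have wge0 (j : nat) : 0 <= weight j by rewrite !mulr_ge0 ?exprn_ge0 ?expR_ge0.
have : \sum_(j < J) \sum_(y in X) \sum_c (level_pair (fun b => Z b x y) c j)%:R * weight j
    <= \sum_(j < J) (weight j * expR (- 9 * j.+1%:R)) * (2 * #|X|%:R).
  apply: ler_sum => j _; rewrite exchange_big /=.
  apply: (@le_trans _ _ (\sum_(c : bool) expR (- 9 * j.+1%:R) * #|X|%:R * weight j)).
    apply: ler_sum => c _; rewrite -mulr_suml; apply: ler_wpM2r => //.
    apply: le_trans (small c j x xX).
    rewrite -natr_sum ler_nat -sum1_card big_mkcond /= [X in (_ <= X)%N]big_mkcond /=.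
    by apply: leq_sum => y _; rewrite !inE; case: (y \in X); case: level_pair.
  by rewrite sumr_const card_bool; lra.
rewrite -mulr_suml; have := weight_sum_le J; rewrite -mulr_natr.
by move: (\sum_(j < J) weight j * _) => S; nra.
Qed.

End Geometric.

(** * Vertices with correlated neighbourhoods *)

Section PopularVertex.
Variables (R : realType) (V : finType).

Lemma card_sum_nat (A : {set V}) : #|A|%:R = \sum_v (v \in A)%:R :> R.
Proof.
by rewrite -natr_sum -sum1_card big_mkcond; congr _%:R; apply: eq_bigr => v _; case: (v \in A).
Qed.

(** The inner product of the normalized, centred indicators
1_(N x) / #|N x| - 1_Y / #|Y|, up to the factor a #|Y|. *)
Lemma gram_codegree (N : V -> {set V}) (Y X : {set V}) (a : R) :
  0 <= a -> Y != set0 -> (forall x, x \in X -> N x \subset Y) ->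
  (forall x, x \in X -> N x != set0) ->
  exists2 Z : V -> V -> R, gram Z & {in X &, forall x y,
    Z x y = a * (#|Y|%:R * #|N x :&: N y|%:R / (#|N x|%:R * #|N y|%:R) - 1)}.
Proof.
move=> a0 Y0 NY N0.
pose u v x : R := (v \in N x)%:R / #|N x|%:R - (v \in Y)%:R / #|Y|%:R.
exists (fun x y => a * #|Y|%:R * \sum_v u v x * u v y).
  by apply: gramM; [apply: gram_cst; rewrite mulr_ge0 | exists V, u].
move=> x y xX yX.
have nz (A : {set V}) : A != set0 -> #|A|%:R != 0 :> R by rewrite pnatr_eq0 cards_eq0.
have -> : \sum_v u v x * u v y = #|N x :&: N y|%:R / (#|N x|%:R * #|N y|%:R) - #|Y|%:R^-1.
  have E v : u v x * u v y = (v \in N x :&: N y)%:R / (#|N x|%:R * #|N y|%:R)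
      - (v \in N x)%:R / (#|N x|%:R * #|Y|%:R) - (v \in N y)%:R / (#|N y|%:R * #|Y|%:R)
      + (v \in Y)%:R / (#|Y|%:R * #|Y|%:R).
    rewrite /u inE; have := subsetP (NY x xX) v; have := subsetP (NY y yX) v.
    have nx := nz _ (N0 x xX); have ny := nz _ (N0 y yX); have nY := nz _ Y0.
    by case: (v \in N x); case: (v \in N y); case: (v \in Y) => // h1 h2;
      rewrite /= ?mul0r; try (by case: notF; auto); field; rewrite ?nx ?ny ?nY.
  under eq_bigr do rewrite E.
  rewrite big_split /= !sumrB -!mulr_suml -!card_sum_nat.
  by field; rewrite !nz ?N0.
by field; rewrite !nz ?N0.
Qed.

(** [correlated_star] for the codegree kernels, scaled by p / a so that one unit of
the kernel is a change of density by a. Degrees may exceed p: the bound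
p #|Y| <= #|N y| absorbs the normalization by #|N y|. *)
Lemma popular_vertex (X : {set V}) (Y : bool -> {set V}) (N : bool -> V -> {set V})
    (p a : bool -> R) :
  X != set0 -> (forall c, Y c != set0) -> (forall c, 0 < p c) -> (forall c, 0 < a c) ->
  (forall c x, x \in X -> N c x \subset Y c) ->
  (forall c x, x \in X -> p c * #|Y c|%:R <= #|N c x|%:R) ->
  exists (c : bool) (j : nat), exists2 x, x \in X & exists X' : {set V},
    [/\ X' \subset X, expR (- 9 * j.+1%:R) * #|X|%:R <= #|X'|%:R :> R &
     forall d y, y \in X' ->
       (p d + a d * ((if d == c then j%:R ^+ 2 else 0) - 3)) * #|N d x|%:R
         <= #|N d x :&: N d y|%:R].
Proof.
move=> X0 Y0 p0 a0 NY degN.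
have Ypos c : 0 < #|Y c|%:R :> R by rewrite ltr0n card_gt0.
have Npos c x : x \in X -> 0 < #|N c x|%:R :> R.
  by move=> xX; apply: lt_le_trans (degN c x xX); rewrite mulr_gt0.
have Nn0 c x : x \in X -> N c x != set0.
  by move=> /(Npos c); rewrite ltr0n card_gt0.
have pa0 c : 0 <= p c / a c by rewrite divr_ge0 // ltW.
have [Zt gZt Zt_eq] := gram_codegree (pa0 true) (Y0 true) (NY true) (Nn0 true).
have [Zf gZf Zf_eq] := gram_codegree (pa0 false) (Y0 false) (NY false) (Nn0 false).
pose Z c := if c then Zt else Zf.
have ZE c x y : x \in X -> y \in X -> Z c x y = p c / a c *
    (#|Y c|%:R * #|N c x :&: N c y|%:R / (#|N c x|%:R * #|N c y|%:R) - 1).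
  by case: c; [apply: Zt_eq | apply: Zf_eq].
have gZ c : gram (Z c) by case: c.
have [c [j [x xX Hx]]] := correlated_star gZ X0.
exists c, j, x => //; exists [set y in X | level_pair (fun b => Z b x y) c j].
split=> //; first by apply/subsetP => y; rewrite inE => /andP[].
move=> d y; rewrite inE => /andP[yX /andP[zc zc']].
(* In both cases l is a lower bound for the kernel of colour d that level_pair gives. *)
set l := (X in a d * X).
have lZ : l <= Z d x y.
  rewrite /l; have [->//|dc] := eqVneq d c.
  by have -> : d = ~~ c; [case: (d) (c) dc => [] [] | rewrite sub0r].
rewrite ZE // in lZ.
have := degN d y yX; have nx := Npos d x xX; have ny := Npos d y yX.
have nY := Ypos d; have ad := a0 d; have pd := p0 d.
move: lZ; set I := #|_ :&: _|%:R; have I0 : 0 <= I by [].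
move: I I0 nx ny nY => I I0 nx ny nY lZ dy.
have h1 : p d + a d * l <= p d * #|Y d|%:R * I / (#|N d x|%:R * #|N d y|%:R).
  have := ler_wpM2l (ltW ad) lZ.
  by rewrite mulrA mulrCA divff ?gt_eqF // mulr1 -!mulrA; lra.
have h2 := ler_wpM2r (ltW nx) h1; apply: le_trans h2 _.
have -> : p d * #|Y d|%:R * I / (#|N d x|%:R * #|N d y|%:R) * #|N d x|%:R
   = p d * #|Y d|%:R * I / #|N d y|%:R.
  by field; rewrite !gt_eqF.
by rewrite ler_pdivrMr // [I * _]mulrC; apply: ler_wpM2r.
Qed.

End PopularVertex.

(** * Elementary estimates *)

Section Estimates.
Variable R : realType.
Implicit Types u e x Lam : R.

Lemma expR1_ge2 : 2 <= expR 1 :> R.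
Proof. by have := expR_ge1Dx (1 : R); lra. Qed.

Lemma expRN2_le : expR (- 2) <= 4^-1 :> R.
Proof.
rewrite expRN lef_pV2 ?posrE ?expR_gt0 //.
have -> : 2 = 1 + 1 :> R by lra.
by rewrite expRD; have := expR1_ge2; nra.
Qed.

Lemma ln1p_ge u : 0 <= u -> u / (1 + u) <= ln (1 + u).
Proof.
move=> u0; have u1 : 0 < 1 + u by lra.
have := @le_ln1Dx R (- (u / (1 + u))).
have -> : 1 + - (u / (1 + u)) = (1 + u)^-1 by field; lra.
rewrite lnV ?posrE // => H.
suff /H : -1 < - (u / (1 + u)) by lra.
by rewrite ltrN2 ltr_pdivrMr // mul1r; lra.
Qed.

Lemma ln1m_ge u : 0 <= u -> u <= 2^-1 -> - (2 * u) <= ln (1 - u).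
Proof.
move=> u0 u1; have v0 : 0 < 1 - u by lra.
have := @le_ln1Dx R (u / (1 - u)).
have -> : 1 + u / (1 - u) = (1 - u)^-1 by field; lra.
rewrite lnV ?posrE // => H.
have : u / (1 - u) <= 2 * u by rewrite ler_pdivrMr //; nra.
suff /H : -1 < u / (1 - u) by lra.
by apply: lt_le_trans (_ : 0 <= _); [lra | rewrite divr_ge0 // ltW].
Qed.

Lemma ln2_le1 : ln 2 <= 1 :> R.
Proof. by have := @le_ln1Dx R 1; rewrite (_ : 1 + 1 = 2 :> R); [apply; lra | lra]. Qed.

Lemma ln2_ge : 2^-1 <= ln 2 :> R.
Proof. by have := @ln1p_ge 1; rewrite (_ : 1 + 1 = 2 :> R); [move=> h; have := h _; lra | lra]. Qed.

Lemma expRN_le x : 0 <= x -> x <= 1 -> expR (- x) <= 1 - x / 2.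
Proof.
move=> x0 x1; rewrite expRN; have h := expR_ge1Dx x; have e0 := expR_gt0 x.
rewrite -[leLHS]mul1r ler_pdivrMr //.
apply: (@le_trans _ _ ((1 - x / 2) * (1 + x))); first by nra.
by apply: ler_wpM2l => //; lra.
Qed.

Lemma expR_le1D2x x : 0 <= x -> x <= 2^-1 -> expR x <= 1 + 2 * x.
Proof.
move=> x0 x1; have h := expR_ge1Dx (- x).
have e0 := expR_gt0 (- x).
rewrite -[x in expR x]opprK expRN -[leLHS]mul1r ler_pdivrMr //.
apply: (@le_trans _ _ ((1 + 2 * x) * (1 + - x))); first by nra.
by apply: ler_wpM2l => //; lra.
Qed.

Lemma Nln1m_le x : 0 <= x -> x <= 2^-1 -> - ln (1 - x) <= x + 2 * x ^+ 2.
Proof.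
move=> x0 x1; have v0 : 0 < 1 - x by lra.
have := @le_ln1Dx R (x / (1 - x)).
have -> : 1 + x / (1 - x) = (1 - x)^-1 by field; lra.
rewrite lnV ?posrE // => H.
have : x / (1 - x) <= x + 2 * x ^+ 2 by rewrite ler_pdivrMr //; nra.
suff /H : -1 < x / (1 - x) by lra.
by apply: lt_le_trans (_ : 0 <= _); [lra | rewrite divr_ge0 // ltW].
Qed.

Lemma Nln1p_le x : 0 <= x -> - ln (1 + x) <= - x + x ^+ 2.
Proof.
move=> x0; have := ln1p_ge x0; have : x - x ^+ 2 <= x / (1 + x).
  by rewrite ler_pdivlMr; nra.
by lra.
Qed.

(** A boost at level j >= mu multiplies the excess density by 1 + u with u close to
j^2 / 3t. For u <= 1 its logarithm is at least u / 2; for u > 1 it is at least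
1/2, and the bound on e forces j to be at most of order sqrt t, hence small
compared with t. *)
Lemma boost_gain (j mu t : nat) e Lam :
  (64 <= mu <= j)%N -> mu%:R ^+ 2 <= 4 * t%:R :> R -> 0 < e ->
  100 * 100 * expR Lam <= t%:R -> - (t%:R * ln e) <= t%:R * Lam ->
  e * (1 + (j%:R ^+ 2 - 3) / (3 * t%:R)) <= 1 ->
  mu%:R ^+ 2 / 8 <= t%:R * ln (1 + (j%:R ^+ 2 - 3) / (3 * t%:R)) :> R /\
  9 * j.+1%:R <= t%:R * ln (1 + (j%:R ^+ 2 - 3) / (3 * t%:R)) :> R.
Proof.
move=> /andP[mu64 muj] mut e0 tLam eLam eu1.
have mu64' : 64 <= mu%:R :> R by rewrite ler_nat.
have muj' : mu%:R <= j%:R :> R by rewrite ler_nat.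
have t0 : 0 < t%:R :> R by nra.
set u := ((j%:R ^+ 2 - 3) / _) in eu1 *.
have uE : 3 * t%:R * u = j%:R ^+ 2 - 3 by rewrite /u; field; lra.
have u0 : 0 < u by rewrite /u divr_gt0 //; nra.
have lu := ln1p_ge (ltW u0).
rewrite -(natr1 j); move: (mu%:R) (j%:R) (t%:R) mu64' muj' t0 mut tLam eLam uE => M J T mu64' muj' t0 mut tLam eLam uE.
have J2 : 64 * J <= J ^+ 2 by rewrite expr2; apply: ler_wpM2r; lra.
have MJ2 : M ^+ 2 <= J ^+ 2 by apply: ler_pM; lra.
have [u1|u1] := leP u 1.
  have : u / 2 <= ln (1 + u).
    by apply: le_trans lu; rewrite ler_pdivlMr ?ler_pdivrMr //; nra.
  move: (ln _) => l ul; have : T * u / 2 <= T * l by rewrite -mulrA ler_pM2l.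
  by split; lra.
have lu2 : 2^-1 <= ln (1 + u).
  by apply: le_trans lu; rewrite ler_pdivlMr; lra.
have : T / 2 <= T * ln (1 + u) by rewrite ler_pM2l.
(* u <= exp Lam because e >= exp (- Lam), so J^2 = O(T u) is much smaller than T^2. *)
have TJ : 18 * (J + 1) <= T.
  have eL : expR (- Lam) <= e.
    rewrite -(@lnK R e) ?posrE // ler_expR -(ler_pM2l t0); lra.
  have uL : 1 + u <= expR Lam.
    rewrite -[leLHS]mul1r -[X in X * _](mulfV (lt0r_neq0 (expR_gt0 Lam))) -mulrA ger_pMr ?expR_gt0 //.
    apply: le_trans eu1; rewrite -expRN; apply: ler_wpM2r => //; lra.
  have uT : 100 * 100 * u <= T by lra.
  have Tu : T * 1 <= T * u by rewrite ler_pM2l // ltW.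
  have M2 : 64 * M <= M ^+ 2 by rewrite expr2; apply: ler_wpM2r; lra.
  have J2u : J ^+ 2 <= 6 * T * u by lra.
  have TT : T * (100 * 100 * u) <= T * T by rewrite ler_pM2l.
  have J3 : 100 * 100 * J ^+ 2 <= 6 * T ^+ 2 by rewrite expr2; lra.
  rewrite leNgt; apply/negP => TJ.
  have TJ' : T <= 20 * J by lra.
  have : T ^+ 2 <= (20 * J) ^+ 2 by apply: ler_pM; lra.
  by rewrite exprMn; lra.
by move=> h; split; lra.
Qed.

End Estimates.

(** * Cliques, books and the Erdos-Szekeres bound *)

Section Books.
Variables (V : finType) (col : rel V).
Hypothesis col_sym : symmetric col.

Definition nbr (c : bool) (x : V) : {set V} := [set y | (y != x) && (col x y == c)].

Definition clique (c : bool) (S : {set V}) : Prop :=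
  forall x y, x \in S -> y \in S -> x != y -> col x y = c.

Definition book (c : bool) (S W : {set V}) : Prop :=
  clique c S /\ forall x, x \in S -> W \subset nbr c x.

Lemma clique_add c x (S : {set V}) :
  S \subset nbr c x -> clique c S -> clique c (x |: S) /\ #|x |: S| = #|S|.+1.
Proof.
move=> Sx cS; split; last first.
  rewrite cardsU1; suff -> : x \notin S by [].
  by apply/negP => /(subsetP Sx); rewrite inE eqxx.
move=> y z; rewrite !inE => /orP[/eqP->|yS] /orP[/eqP->|zS]; rewrite ?eqxx // => yz.
- by have := subsetP Sx z zS; rewrite inE => /andP[_ /eqP].
- by rewrite col_sym; have := subsetP Sx y yS; rewrite inE => /andP[_ /eqP].
- exact: cS.
Qed.

Lemma clique0 c : clique c set0.
Proof. by move=> x y; rewrite inE. Qed.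

Lemma card_le_nbr (X : {set V}) x :
  (#|X| <= (#|X :&: nbr true x| + #|X :&: nbr false x|).+1)%N.
Proof.
have sub : X \subset x |: ((X :&: nbr true x) :|: (X :&: nbr false x)).
  apply/subsetP => y yX; rewrite !inE yX /=.
  by case: (y == x) => //=; case: (col x y).
apply: leq_trans (subset_leq_card sub) _.
rewrite cardsU1 -add1n leq_add ?leq_b1 //.
by rewrite cardsU leq_subr.
Qed.

End Books.

Definition update (A : Type) (f : bool -> A) (c : bool) (a : A) : bool -> A :=
  fun d => if d == c then a else f d.

Section Cliques.
Variables (R : realType) (V : finType) (col : rel V).
Hypothesis col_sym : symmetric col.
Implicit Types (A S W : {set V}) (a : bool -> nat).

Definition has_clique A a := exists c S, [/\ S \subset A, #|S| = a c & clique col c S].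

Lemma has_clique0 A a c : a c = 0%N -> has_clique A a.
Proof. by move=> ac; exists c, set0; rewrite sub0set cards0; split=> //; apply: clique0. Qed.

(** Erdos-Szekeres step: a clique in the neighbourhood of x can be extended by x if
it has the colour of the neighbourhood. *)
Lemma has_clique_step A a x c : x \in A -> (0 < a c)%N ->
  has_clique (nbr col c x :&: A) (update a c (a c).-1) -> has_clique A a.
Proof.
move=> xA ac [d [S [SA Sd cS]]]; move: SA Sd; rewrite subsetI => /andP[Sx SA].
rewrite /update; case: eqVneq => [dc|_] Sd; last by exists d, S.
subst d; have [cS' Ss'] := clique_add col_sym Sx cS; exists c, (x |: S); split=> //.
  by rewrite subUset sub1set xA.
by rewrite Ss' Sd prednK.
Qed.

(** Weighted Erdos-Szekeres: with weights exp (- b c) summing to at most 1, one of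
the two neighbourhoods of any vertex has at least its weighted share. The bound
on #|A| + 1 instead of #|A| makes up for the vertex itself, since
#|A| + 1 <= (#|N_t| + 1) + (#|N_f| + 1). *)
Lemma erdos_szekeres (b : bool -> R) a A :
  (expR (- b true) + expR (- b false) <= 1) ->
  expR (b true * (a true)%:R + b false * (a false)%:R) <= #|A|%:R + 1 ->
  has_clique A a.
Proof.
move=> b1; have [n] := ubnP (a true + a false)%N.
elim: n a A => // n IH a A an hA.
have [/existsP[c /eqP ac]|s0] := boolP [exists c, a c == 0%N]; first exact: has_clique0 ac.
have {}s0 c : (0 < a c)%N by move/existsPn: s0 => /(_ c); rewrite lt0n.
have b0 c : 0 < b c.
  rewrite -oppr_lt0 -expR_lt1; move: b1 (expR_gt0 (- b (~~ c))).
  by case: c => /=; lra.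
have [x xA] : exists x, x \in A.
  apply/set0Pn; rewrite -card_gt0 -(ltr0n R) -(ltrD2r 1) add0r.
  by apply: lt_le_trans hA; rewrite expR_gt1 addr_gt0 // mulr_gt0 // ltr0n.
suff [c hc] : exists c, expR (- b c) * expR (b true * (a true)%:R + b false * (a false)%:R)
    <= #|nbr col c x :&: A|%:R + 1.
  apply: (has_clique_step xA (s0 c)); apply: IH.
    move: an; rewrite /update; have := s0 c; case: (c) => /=; case: (a _) => //= m _; rewrite ?addSn ?addnS; exact.
  apply: le_trans hc; rewrite -expRD ler_expR /update.
  have : (a c)%:R = (a c).-1%:R + 1 :> R by rewrite natr1 prednK.
  by case: (c) => /= ->; lra.
have cA : #|A|%:R <= #|nbr col true x :&: A|%:R + #|nbr col false x :&: A|%:R + 1 :> R.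
  by rewrite -natrD natr1 ler_nat; have := card_le_nbr col A x; rewrite ![A :&: _]setIC.
set E := expR (b true * _ + _) in hA *.
have E0 : 0 < E by apply: expR_gt0.
have E1 : (expR (- b true) + expR (- b false)) * E <= E by rewrite ger_pMl.
have [ht|ht] := leP (expR (- b true) * E) (#|nbr col true x :&: A|%:R + 1); first by exists true.
by exists false; lra.
Qed.

(** A clique among the pages is joined to S if it has the colour of the book. *)
Lemma book_extend c S W A a : book col c S W -> S \subset A -> W \subset A ->
  (#|S| <= a c)%N -> has_clique W (update a c (a c - #|S|)%N) -> has_clique A a.
Proof.
move=> [cS nS] SA WA Sa [d [T [TW Td cT]]]; move: Td; rewrite /update.
case: eqVneq => [dc|_] Td; last by exists d, T; split=> //; apply: subset_trans WA.
subst d; exists c, (S :|: T); split.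
- by rewrite subUset SA (subset_trans TW).
- rewrite cardsU; suff -> : S :&: T = set0 by rewrite cards0 subn0 Td subnKC.
  apply/setP => z; rewrite !inE; apply/negP => /andP[zS zT].
  by have := subsetP (nS z zS) z (subsetP TW z zT); rewrite inE eqxx.
- have ST x y : x \in S -> y \in T -> col x y = c.
    move=> xS yT; have := subsetP (nS x xS) y (subsetP TW y yT).
    by rewrite inE => /andP[_ /eqP].
  move=> x y; rewrite !inE => /orP[xS|xT] /orP[yS|yT] xy.
  + exact: cS.
  + exact: ST.
  + by rewrite col_sym; apply: ST.
  + exact: cT.
Qed.

End Cliques.

(** * The book algorithm *)

Section BookAlgorithm.
Variables (V : finType) (col : rel V) (R : realType).
Hypothesis col_sym : symmetric col.

Section Algorithm.
Variables (t mu : nat) (beta Lam m : R).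
Hypotheses (mu64 : (64 <= mu)%N) (mut : mu%:R ^+ 2 <= 4 * t%:R :> R)
  (tLam : 100 * 100 * expR Lam <= t%:R) (beta0 : 0 <= beta) (m0 : 0 < m).

(** A boost lowers the potential below by at least K, and a colour step keeps a
proportion of at least exp (- G) of the reservoir. *)
Let K : R := mu%:R ^+ 2 / 8.
Let G : R := 9 * mu%:R + 2.

(** Potential of one colour: e is the excess of its density over exp (- beta), and
s the number of vertices that its book still needs. A colour step replaces e by
e (1 - 1/t), which raises - t ln e by at most 2, and lowers s by 1; so the
potential never grows. *)
Definition excess (e : R) (s : nat) : R := 2 * s%:R - t%:R * ln e.

(** The invariant of the algorithm. The reservoir pays exp G for each vertex still to
be put into a book, and exp 1 per unit of potential. The pages of colour c pay
exp beta for each such vertex, and for each boost; a boost costs at least K units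
of potential, so that there are at most excess / K of them. *)
Definition state_ok (X : {set V}) (Y : bool -> {set V}) (e : bool -> R) (s : bool -> nat) :=
  [/\ forall c, 0 < e c /\ excess (e c) (s c) <= t%:R * Lam,
      forall c x, x \in X -> (expR (- beta) + e c) * #|Y c|%:R <= #|nbr col c x :&: Y c|%:R,
      expR (G * (s true + s false)%:R + excess (e true) (s true) + excess (e false) (s false))
        <= #|X|%:R &
      forall c, m * expR (beta * ((s c)%:R + excess (e c) (s c) / K)) <= #|Y c|%:R].

(** Every step lowers this quantity by at least K. *)
Definition fuel (e : bool -> R) (s : bool -> nat) : R :=
  K * (s true + s false)%:R + excess (e true) (s true) + excess (e false) (s false).

Lemma mu_ge64 : 64 <= mu%:R :> R. Proof. by rewrite ler_nat. Qed.

Lemma t_ge2 : 2 <= t%:R :> R.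
Proof.
have h := mu_ge64.
have : 64 * mu%:R <= mu%:R ^+ 2 :> R by rewrite expr2; apply: ler_wpM2r.
by move: mut h; lra.
Qed.

Lemma t_gt0 : 0 < t%:R :> R. Proof. by have := t_ge2; lra. Qed.

Lemma K_gt0 : 0 < K.
Proof. by have := mu_ge64 => h; rewrite /K divr_gt0 // exprn_gt0 //; lra. Qed.

Section State.
Variables (X : {set V}) (Y : bool -> {set V}) (e : bool -> R) (s : bool -> nat).
Hypothesis ok : state_ok X Y e s.

Lemma state_X_neq0 : X != set0.
Proof.
have [_ _ hX _] := ok.
by rewrite -card_gt0 -(ltr0n R); apply: lt_le_trans hX; apply: expR_gt0.
Qed.

Lemma state_Y_gt0 c : 0 < #|Y c|%:R :> R.
Proof.
have [_ _ _ hY] := ok.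
by apply: lt_le_trans (hY c); rewrite mulr_gt0 ?expR_gt0.
Qed.

Lemma state_density_le1 (d : R) c (x : V) :
  0 < d -> d * #|Y c|%:R <= #|nbr col c x :&: Y c|%:R -> d <= 1.
Proof.
move=> d0 h; rewrite -(ler_pM2r (state_Y_gt0 c)) mul1r.
by apply: le_trans h _; rewrite ler_nat subset_leq_card ?subsetIr.
Qed.

Lemma state_e_le1 c : e c <= 1.
Proof.
have [/(_ c)[e0 _] deg _ _] := ok; have [x xX] := set0Pn _ state_X_neq0.
have b0 := expR_gt0 (- beta).
by have := state_density_le1 (addr_gt0 b0 e0) (deg c x xX); lra.
Qed.

Lemma state_excess_ge0 c : 0 <= excess (e c) (s c).
Proof.
rewrite /excess subr_ge0 (@le_trans _ _ 0) ?mulr_ge0 //.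
by rewrite mulr_ge0_le0 // ln_le0 // state_e_le1.
Qed.

Lemma state_stop c : s c = 0%N ->
  exists c (S W : {set V}), [/\ book col c S W, S \subset X, #|S| = s c, W \subset Y c
    & m <= #|W|%:R].
Proof.
move=> sc; exists c, set0, (Y c); split; rewrite ?sub0set ?cards0 //.
  by split; [apply: clique0 | move=> x; rewrite inE].
have [_ _ _ hY] := ok; apply: le_trans (hY c).
rewrite ler_peMr ?(ltW m0) //; apply: le_trans (expR_ge1Dx _).
rewrite lerDl mulr_ge0 // addr_ge0 //.
by rewrite divr_ge0 ?state_excess_ge0 // ltW // K_gt0.
Qed.

(** The colour d is the majority colour of x on X'. A quarter of X' survives because
#|X'| >= 2, and this is the constant 2 in G. *)
Lemma colour_step (x : V) (X' : {set V}) :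
  (forall c, 0 < s c)%N -> x \in X -> X' \subset X ->
  expR (- 9 * mu%:R) * #|X|%:R <= #|X'|%:R :> R ->
  (forall d y, y \in X' -> (expR (- beta) + e d * (1 - t%:R^-1)) * #|nbr col d x :&: Y d|%:R
     <= #|nbr col d y :&: (nbr col d x :&: Y d)|%:R) ->
  exists d, let e' := update e d (e d * (1 - t%:R^-1)) in
    let s' := update s d (s d).-1 in
    state_ok (X' :&: nbr col d x) (update Y d (nbr col d x :&: Y d)) e' s' /\
    fuel e' s' + K <= fuel e s.
Proof.
move=> s0 xX X'X hX' hpop; have [eok deg hX hY] := ok.
have t2 := t_ge2; have t0 := t_gt0.
have tV : 0 < t%:R^-1 :> R by rewrite invr_gt0.
have tV2 : t%:R^-1 <= 2^-1 :> R by rewrite lef_pV2 ?posrE.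
set E := (X in expR X <= _) in hX.
have E2 : 2 * G <= E + 9 * mu%:R.
  have := state_excess_ge0 true; have := state_excess_ge0 false.
  have : 2 <= (s true + s false)%:R :> R.
    by rewrite ler_nat (leq_add (s0 true) (s0 false)).
  have := mu_ge64; rewrite /E /G; move: ((s true + s false)%:R) (mu%:R) => p q q64 p2 e0 e1.
  have : (9 * q + 2) * 2 <= (9 * q + 2) * p by apply: ler_wpM2l => //; lra.
  by lra.
have hX'' : expR (E - 9 * mu%:R) <= #|X'|%:R.
  by apply: le_trans hX'; rewrite addrC expRD -mulNr; apply: ler_wpM2l => //; apply: expR_ge0.
have X'2 : 2 <= #|X'|%:R :> R.
  apply: le_trans hX''; apply: le_trans (expR_ge1Dx _).
  by have := mu_ge64; move: E2; rewrite /G; lra.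
(* The more frequent colour at x: the factor 4 = 2 * 2 allows for x itself. *)
have [d hd] : exists d, expR (E - 9 * mu%:R - 2) <= #|X' :&: nbr col d x|%:R.
  have h : expR (E - 9 * mu%:R - 2) <= #|X'|%:R / 4.
    by rewrite expRD mulrC [leRHS]mulrC; apply: ler_pM; rewrite ?expR_ge0 ?expRN2_le.
  have : #|X'|%:R <= #|X' :&: nbr col true x|%:R + #|X' :&: nbr col false x|%:R + 1 :> R.
    by rewrite -natrD natr1 ler_nat card_le_nbr.
  have [ht|hf] := leP (#|X' :&: nbr col false x|%:R : R) (#|X' :&: nbr col true x|%:R).
    by exists true; lra.
  by exists false; lra.
exists d => /=.
have lnd : excess (e d * (1 - t%:R^-1)) (s d).-1 <= excess (e d) (s d).
  have [e0 _] := eok d; rewrite /excess lnM ?posrE //; last by lra.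
  have -> : (s d)%:R = (s d).-1%:R + 1 :> R by rewrite natr1 prednK.
  have := ler_wpM2l (ltW t0) (ln1m_ge (ltW tV) tV2).
  rewrite mulrN mulrCA mulfV ?gt_eqF //; lra.
have sd : (s d)%:R = (s d).-1%:R + 1 :> R by rewrite natr1 prednK.
split; last first.
  rewrite /fuel /update !natrD.
  by case: (d) sd lnd => /= -> ?; lra.
split.
- move=> c; have [e0 ec] := eok c; rewrite /update; case: eqVneq => // cd; subst c.
  by split; [rewrite mulr_gt0 // subr_gt0; lra | apply: le_trans ec].
- move=> c y; rewrite inE => /andP[yX' yx]; rewrite /update; case: eqVneq => [->|_].
    exact: hpop.
  by apply: deg; apply: (subsetP X'X).
- apply: le_trans hd; rewrite ler_expR /E /G /update !natrD.
  by case: (d) sd lnd => /= -> ?; lra.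
- move=> c; rewrite /update; case: eqVneq => // cd; subst c.
  have xd := deg d x xX; have [e0 _] := eok d; have hYd := hY d.
  apply: le_trans (_ : expR (- beta) * #|Y d|%:R <= _); last first.
    by apply: le_trans xd; apply: ler_wpM2r => //; lra.
  apply: le_trans (ler_wpM2l (expR_ge0 (- beta)) hYd).
  rewrite mulrCA; apply: ler_wpM2l; first exact: ltW.
  rewrite -expRD ler_expR sd.
  have : excess (e d * (1 - t%:R^-1)) (s d).-1 / K <= excess (e d) (s d) / K.
    by rewrite ler_pM2r // invr_gt0 K_gt0.
  move: (_ / K) (_ / K) => p q pq; have := ler_wpM2l beta0 pq; lra.
Qed.

Lemma boost_step (j : nat) (c : bool) (x : V) (X' : {set V}) :
  (mu <= j)%N -> x \in X -> X' \subset X ->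
  expR (- 9 * j.+1%:R) * #|X|%:R <= #|X'|%:R :> R ->
  (forall y, y \in X' ->
     (expR (- beta) + e c * (1 + (j%:R ^+ 2 - 3) / (3 * t%:R))) * #|nbr col c x :&: Y c|%:R
       <= #|nbr col c y :&: (nbr col c x :&: Y c)|%:R) ->
  state_ok X' (update Y c (nbr col c x :&: Y c))
    (update e c (e c * (1 + (j%:R ^+ 2 - 3) / (3 * t%:R)))) s /\
  fuel (update e c (e c * (1 + (j%:R ^+ 2 - 3) / (3 * t%:R)))) s + K <= fuel e s.
Proof.
move=> muj xX X'X hX'; set u := ((j%:R ^+ 2 - 3) / _) => hpop.
set e' := update e c _; have [eok deg hX hY] := ok.
have t0 := t_gt0; have [e0 eL] := eok c.
have e'c : e' c = e c * (1 + u) by rewrite /e' /update eqxx.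
have M64 := mu_ge64.
have u0 : 0 < u.
  have : mu%:R <= j%:R :> R by rewrite ler_nat.
  by move=> mj; rewrite /u divr_gt0 ?mulr_gt0 //; nra.
have X'0 : 0 < #|X'|%:R :> R.
  apply: lt_le_trans hX'; rewrite mulr_gt0 ?expR_gt0 //.
  by apply: lt_le_trans hX; apply: expR_gt0.
have b0 := expR_gt0 (- beta).
have hYx : expR (- beta) * #|Y c|%:R <= #|nbr col c x :&: Y c|%:R.
  by apply: le_trans (deg c x xX); apply: ler_wpM2r => //; lra.
have eu0 : 0 < e c * (1 + u) by rewrite mulr_gt0 //; lra.
have eu1 : e c * (1 + u) <= 1.
  have [y yX'] : exists y, y \in X' by apply/set0Pn; rewrite -card_gt0 -(ltr0n R).
  have h := hpop y yX'.
  have N0 : 0 < #|nbr col c x :&: Y c|%:R :> R.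
    by apply: lt_le_trans hYx; rewrite mulr_gt0 ?state_Y_gt0.
  have : (expR (- beta) + e c * (1 + u)) * #|nbr col c x :&: Y c|%:R <= 1 * #|nbr col c x :&: Y c|%:R.
    by rewrite mul1r; apply: le_trans h _; rewrite ler_nat subset_leq_card ?subsetIr.
  by rewrite ler_pM2r //; lra.
have eL' : - (t%:R * ln (e c)) <= t%:R * Lam.
  by apply: le_trans eL; rewrite /excess lerDr mulr_ge0.
have [gK gj] := boost_gain (introT andP (conj mu64 muj)) mut e0 tLam eL' eu1.
rewrite -/K -/u in gK gj.
have exE : excess (e' c) (s c) = excess (e c) (s c) - t%:R * ln (1 + u).
  by rewrite e'c /excess lnM ?posrE //; [lra | lra].
have e'n : e' (~~ c) = e (~~ c) by rewrite /e' /update; case: (c).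
have sumE : excess (e' true) (s true) + excess (e' false) (s false) =
    excess (e true) (s true) + excess (e false) (s false) - t%:R * ln (1 + u).
  by move: exE e'n; case: (c) => /= exE e'n; rewrite exE e'n; ring.
have K0 := K_gt0.
split; last by rewrite /fuel; move: sumE gK; lra.
split.
- move=> d; have [->|dc] := eqVneq d c; last by rewrite /e' /update (negPf dc).
  by split; [rewrite e'c | rewrite exE; move: eL gK K0; lra].
- move=> d y yX'; have [->|dc] := eqVneq d c; first by rewrite e'c /update eqxx; apply: hpop.
  by rewrite /e' /update (negPf dc); apply: deg; apply: (subsetP X'X).
- apply: le_trans hX'; apply: le_trans (ler_wpM2l (expR_ge0 _) hX).
  by rewrite -expRD ler_expR; move: sumE gj; lra.
- move=> d; have [->|dc] := eqVneq d c; last by rewrite /e' /update (negPf dc).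
  rewrite /update eqxx.
  apply: le_trans hYx; apply: le_trans (ler_wpM2l (ltW b0) (hY c)).
  rewrite mulrCA; apply: ler_wpM2l; first exact: ltW.
  rewrite -expRD ler_expR exE.
  have : 1 <= t%:R * ln (1 + u) / K by rewrite ler_pdivlMr // mul1r.
  rewrite mulrBl; move: (_ / K) (_ / K) => p q p1.
  by have := ler_wpM2l beta0 p1; lra.
Qed.

End State.

Lemma book_algorithm n (X : {set V}) (Y : bool -> {set V}) (e : bool -> R) (s : bool -> nat) :
  state_ok X Y e s -> fuel e s <= K * n%:R ->
  exists c (S W : {set V}), [/\ book col c S W, S \subset X, #|S| = s c, W \subset Y c
    & m <= #|W|%:R].
Proof.
have K0 := K_gt0; have t0 := t_gt0.
elim: n X Y e s => [|n IH] X Y e s ok hn.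
all: have [c0|s0] := boolP [exists c, s c == 0%N];
  first by case/existsP: c0 => c /eqP sc; exact: (state_stop ok sc).
all: have {}s0 c : (0 < s c)%N by move/existsPn: s0 => /(_ c); rewrite lt0n.
  exfalso; have := state_excess_ge0 ok true; have := state_excess_ge0 ok false.
  have : 0 < K * (s true + s false)%:R by rewrite mulr_gt0 // ltr0n addn_gt0 s0.
  by move: hn; rewrite /fuel mulr0; lra.
have [eok deg hX hY] := ok.
have Y0 c : Y c != set0 by rewrite -card_gt0 -(ltr0n R) (state_Y_gt0 ok).
have e0 c : 0 < e c by have [] := eok c.
have p0 c : 0 < expR (- beta) + e c by rewrite addr_gt0 // expR_gt0.
have a0 c : 0 < e c / (3 * t%:R) by rewrite divr_gt0 // mulr_gt0.
have [c [j [x xX [X' [X'X hX' hpop]]]]] :=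
  popular_vertex (state_X_neq0 ok) Y0 p0 a0 (fun c x _ => subsetIr (nbr col c x) (Y c)) deg.
have NI d y : (nbr col d x :&: Y d) :&: (nbr col d y :&: Y d) = nbr col d y :&: (nbr col d x :&: Y d).
  by apply/setP => z; rewrite !inE; case: (z \in Y d); rewrite ?andbF ?andbT // andbC.
have t1 : t%:R != 0 :> R by rewrite gt_eqF.
have [jmu|muj] := ltnP j mu.
- have [||d [ok' f']] := colour_step ok s0 xX X'X.
  + apply: le_trans hX'; apply: ler_wpM2r => //; rewrite ler_expR !mulNr lerN2.
    by rewrite ler_wpM2l // ler_nat.
  + move=> d y yX'; rewrite -NI; apply: le_trans (hpop d y yX').
    apply: ler_wpM2r => //.
    have -> : expR (- beta) + e d * (1 - t%:R^-1) =
        expR (- beta) + e d + e d / (3 * t%:R) * (0 - 3) by field.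
    by rewrite lerD2l ler_wpM2l ?(ltW (a0 d)) // lerD2r; case: eqP => // _; rewrite sqr_ge0.
  have fn : fuel (update e d (e d * (1 - t%:R^-1))) (update s d (s d).-1) <= K * n%:R.
    by move: hn f'; rewrite -natr1; lra.
  have [c' [S [W [[cS nS] SX Ss WY mW]]]] := IH _ _ _ _ ok' fn.
  move: SX Ss WY; rewrite /update subsetI; case: eqVneq => [cd|_] /andP[SX Sx] Ss WY.
  + subst c'; have [cS' Ss'] := clique_add col_sym Sx cS.
    exists d, (x |: S), W; split=> //.
    * split=> // z; rewrite !inE => /orP[/eqP->|/nS//].
      by apply: subset_trans WY (subsetIl _ _).
    * by rewrite subUset sub1set xX; apply: subset_trans X'X.
    * by rewrite Ss' Ss prednK.
    * by apply: subset_trans WY (subsetIr _ _).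
  + by exists c', S, W; split=> //; apply: subset_trans X'X.
- have [|ok' f'] := boost_step (c := c) ok muj xX X'X hX'.
    move=> y yX'; rewrite -NI; apply: le_trans (hpop c y yX').
    apply: ler_wpM2r => //; rewrite eqxx.
    rewrite le_eqVlt; apply/orP; left; apply/eqP; field; exact: t1.
  have fn : fuel (update e c (e c * (1 + (j%:R ^+ 2 - 3) / (3 * t%:R)))) s <= K * n%:R.
    by move: hn f'; rewrite -natr1; lra.
  have [c' [S [W [bSW SX Ss WY mW]]]] := IH _ _ _ _ ok' fn.
  exists c', S, W; split=> //; first exact: subset_trans X'X.
  apply: subset_trans WY _; rewrite /update; case: eqVneq => // ->; exact: subsetIr.
Qed.

End Algorithm.

(** The algorithm started with excess delta and target t in both colours. *)
Theorem monochromatic_book (t mu : nat) (beta delta m : R) (X : {set V}) (Y : bool -> {set V}) :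
  let Lam := 2 - ln delta in
  (64 <= mu)%N -> mu%:R ^+ 2 <= 4 * t%:R :> R -> 100 * 100 * expR Lam <= t%:R ->
  0 <= beta -> 0 < delta -> 0 < m ->
  (forall c x, x \in X -> (expR (- beta) + delta) * #|Y c|%:R <= #|nbr col c x :&: Y c|%:R) ->
  expR (2 * t%:R * (9 * mu%:R + 2 + Lam)) <= #|X|%:R ->
  (forall c, m * expR (beta * t%:R * (1 + Lam / (mu%:R ^+ 2 / 8))) <= #|Y c|%:R) ->
  exists c (S W : {set V}), [/\ book col c S W, S \subset X, #|S| = t, W \subset Y c
    & m <= #|W|%:R].
Proof.
move=> Lam mu64 mut tLam beta0 delta0 m0 deg hX hY.
have ok : state_ok t mu beta Lam m X Y (fun => delta) (fun => t).
  have exE : excess t delta t = t%:R * Lam by rewrite /excess /Lam; ring.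
  split=> //.
  - by move=> c; rewrite exE.
  - apply: le_trans hX; rewrite ler_expR exE natrD; lra.
  - move=> c; apply: le_trans (hY c); apply: ler_wpM2l; first exact: ltW.
    by rewrite ler_expR exE; lra.
have K0 : 0 < mu%:R ^+ 2 / 8 :> R by rewrite divr_gt0 // exprn_gt0 // ltr0n (leq_trans _ mu64).
pose n := Num.bound (fuel t mu (fun => delta) (fun => t) / (mu%:R ^+ 2 / 8)).
have F0 : 0 <= fuel t mu (fun => delta) (fun => t) / (mu%:R ^+ 2 / 8).
  have exx := state_excess_ge0 m0 ok.
  rewrite divr_ge0 ?(ltW K0) //; apply: addr_ge0 (exx false); apply: addr_ge0 (exx true).
  by apply: mulr_ge0 => //; apply: ltW.
apply: (book_algorithm mu64 mut tLam beta0 m0 ok (n := n)).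
by have := ltW (archi_boundP F0); rewrite ler_pdivrMr // mulrC.
Qed.

End BookAlgorithm.

(** * Regular colourings and unbalanced steps *)

(** The hierarchy of parameters: mu is the threshold of the book algorithm, eps the
tolerance in the degrees and also the initial excess density, u the number of
unbalanced Erdos-Szekeres steps, and 8 u the size of the book, where k is close
to 512 mu u. So eps is of order 1 / mu with a small constant, and Lam,
which is of order log mu, is much smaller than mu. *)
Record scales (R : realType) (mu u k : nat) (M U eps Lam : R) : Prop := Scales {
  scale_M : M = mu%:R;
  scale_U : U = u%:R;
  scale_Lam : Lam = 2 - ln eps;
  scale_eps : 128 * 256 * (eps * M) = 1;
  scale_M_ge : 64 <= M;
  scale_Lam_le : 128 * 256 * Lam <= M;
  scale_U_ge : M ^+ 2 <= U;
  scale_U_geLam : 100 * 100 * expR Lam <= U;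
  scale_U_geV : 2 / eps <= U;
  scale_k_ge : 512 * M * U <= k%:R;
  scale_k_le : k%:R <= 512 * M * U + U
}.

Section Improvement.
Variables (R : realType) (mu u k : nat) (M U eps Lam : R).
Hypothesis sc : scales mu u k M U eps Lam.

Lemma scales_facts : [/\ 0 < M, 0 < U, 0 < eps, 128 * 256 * 64 * eps <= 1 & 64 * U <= M * U].
Proof.
case: sc => ME UE LamE epsM M64 MLam uM uLam ueps klo khi.
have M0 : 0 < M by lra.
have U0 : 0 < U by apply: lt_le_trans uM; rewrite exprn_gt0.
have eps0 : 0 < eps by rewrite -(pmulr_lgt0 _ M0); lra.
split=> //; first by have := ler_wpM2l (ltW eps0) M64; lra.
by rewrite ler_pM2r.
Qed.

Variables (V : finType) (col : rel V).
Hypothesis col_sym : symmetric col.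
Implicit Types (A : {set V}) (a : bool -> nat).

(** All sets considered have at least exp (500 M U) vertices, while a reservoir for
books of size 8 U only needs exp (160 M U). *)
Lemma large_exponent a (x : R) : (forall c, k <= a c + u)%N -> x <= U ->
  500 * M * U <= (a true + a false)%:R * ln 2 - eps * x / 2.
Proof.
case: sc => ME UE LamE epsM M64 MLam uM uLam ueps klo khi.
have [M0 U0 eps0 eps_le MU] := scales_facts.
move=> ka xU.
have h c : k%:R <= (a c)%:R + U by rewrite UE -natrD ler_nat ka.
have := h true; have := h false; rewrite natrD => hf ht.
have l2 := @ln2_ge R.
have : ((a true)%:R + (a false)%:R) * 2^-1 <= ((a true)%:R + (a false)%:R) * ln 2 :> R.
  by apply: ler_wpM2l => //; apply: addr_ge0.
have : eps * x <= eps * U by rewrite ler_pM2l.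
have : eps * U <= 1 * U by apply: ler_wpM2r; [apply: ltW | lra].
by lra.
Qed.

(** With eta of order 1 / mu, the first-order terms contribute
eta (a c - 8 U - a (~~ c)) <= - 7 eta U, and the second-order terms at most
3 eta^2 k, close to 3 eta U. *)
Lemma unbalanced_bound a c (eta : R) : 512 * (eta * M) = 1 ->
  (forall d, k <= a d + u)%N -> (forall d, a d <= k)%N ->
  (ln 2 - ln (1 - eta)) * ((a c)%:R - 8 * U) + (ln 2 - ln (1 + eta)) * (a (~~ c))%:R
   <= ((a c)%:R + (a (~~ c))%:R - 8 * U) * ln 2 - U / (192 * M).
Proof.
case: sc => ME UE LamE epsM M64 MLam uM uLam ueps klo khi.
have [M0 U0 eps0 eps_le MU] := scales_facts.
move=> etaM ka ak.
have eta0 : 0 < eta by rewrite -(pmulr_lgt0 _ M0); lra.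
have eta_le : 512 * 64 * eta <= 1 by have := ler_wpM2l (ltW eta0) M64; lra.
have h d : k%:R <= (a d)%:R + U by rewrite UE -natrD ler_nat ka.
have h' d : (a d)%:R <= k%:R :> R by rewrite ler_nat ak.
have a0 : 0 <= (a c)%:R - 8 * U by have := h c; lra.
have e1 := ltW eta0; have e2 : eta <= 2^-1 by lra.
have := ler_wpM2r a0 (Nln1m_le e1 e2).
have := ler_wpM2r (ler0n R (a (~~ c))) (Nln1p_le e1).
have : eta * ((a c)%:R - 8 * U - (a (~~ c))%:R) <= eta * (- 7 * U).
  by apply: ler_wpM2l => //; have := h (~~ c); have := h' c; lra.
have : eta ^+ 2 * (2 * ((a c)%:R - 8 * U) + (a (~~ c))%:R) <= eta ^+ 2 * (3 * (512 * M * U + U)).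
  apply: ler_wpM2l; first by rewrite sqr_ge0.
  by have := h' (~~ c); have := h' c; lra.
have -> : eta ^+ 2 * (3 * (512 * M * U + U)) = 3 * eta * U * (512 * (eta * M) + eta) by ring.
have -> : U / (192 * M) = 512 / 192 * (eta * U).
  have -> : U / (192 * M) = 512 * (eta * M) * U / (192 * M) by rewrite etaM mul1r.
  by field; lra.
rewrite etaM.
have : 3 * eta * U * (1 + eta) <= 3 * eta * U * (1 + 1/64).
  by apply: ler_wpM2l; [rewrite !mulr_ge0 // ltW | lra].
by have := mulr_gt0 eta0 U0; lra.
Qed.

(** What the pages lose beyond 2^(8 u): the degrees fall short of 1/2 by O(eps), and
the boosts cost a proportion O(Lam / M^2) of the exponent. Both are a small
multiple of 1 / M. *)
Lemma overhead_bound :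
  (ln 2 + 8 * eps) * (8 * U) * (1 + Lam / (M ^+ 2 / 8)) <=
    8 * U * ln 2 + U / (192 * M) - eps * U / 2.
Proof.
have [M0 U0 eps0 eps_le _] := scales_facts.
have [epsM MLam] : 128 * 256 * (eps * M) = 1 /\ 128 * 256 * Lam <= M by case: sc.
have l2 := @ln2_le1 R; have l1 := @ln2_ge R.
have [q qE] : exists q, q = 128 * 256 * eps by exists (128 * 256 * eps).
have qM : q * M = 1 by rewrite qE -mulrA.
have q0 : 0 < q by rewrite qE; lra.
have -> : U / (192 * M) = U * q / 192.
  by rewrite -[q](mulfK (lt0r_neq0 M0)) qM; field; lra.
have -> : Lam / (M ^+ 2 / 8) = 8 * q * (q * Lam).
  by rewrite -[q](mulfK (lt0r_neq0 M0)) qM; field; lra.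
have epsE : eps = q / (128 * 256) by rewrite qE; field.
have qL : q * Lam <= (128 * 256)^-1.
  by have := ler_wpM2l (ltW q0) MLam; rewrite qM; lra.
have e8 : ln 2 + 8 * eps <= 5 / 4 by move: eps_le l2; lra.
have e0 : 0 <= ln 2 + 8 * eps by move: eps0 l1; lra.
have U8 : 0 <= 8 * U by move: U0; lra.
have h1 : (ln 2 + 8 * eps) * (8 * U) * (8 * q * (q * Lam)) <=
    5 / 4 * (8 * U) * (8 * q * (128 * 256)^-1).
  have q8 : 0 <= 8 * q by move: q0; lra.
  apply: le_trans (ler_wpM2l (mulr_ge0 e0 U8) (ler_wpM2l q8 qL)) _.
  apply: ler_wpM2r; last exact: ler_wpM2r.
  by rewrite mulr_ge0 // invr_ge0 mulr_ge0.
have := mulr_gt0 U0 q0.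
by rewrite mulrDr mulr1; move: h1; move: (8 * q * (q * Lam)) => r; rewrite epsE; lra.
Qed.

(** One round of the book algorithm on A, with A as reservoir and as pages, followed
by the unbalanced Erdos-Szekeres bound in the pages found. *)
Lemma clique_in_regular A a :
  (forall c, k <= a c + u)%N -> (forall c, a c <= k)%N ->
  (forall c x, x \in A -> (2^-1 - eps) * #|A|%:R <= #|nbr col c x :&: A|%:R) ->
  expR ((a true + a false)%:R * ln 2 - eps * U / 2) <= #|A|%:R ->
  has_clique col A a.
Proof.
case: sc => ME UE LamE epsM M64 MLam uM uLam ueps klo khi.
have [M0 U0 eps0 eps_le MU] := scales_facts.
move=> ka ak deg hA.
have [eta etaM] : exists eta : R, 512 * (eta * M) = 1 by exists (512 * M)^-1; field; lra.
have eta0 : 0 < eta by rewrite -(pmulr_lgt0 _ M0); lra.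
have eta_le : 512 * 64 * eta <= 1 by have := ler_wpM2l (ltW eta0) M64; lra.
have [l1 l2] := (@ln2_ge R, @ln2_le1 R).
set s := (a true + a false)%:R * ln 2 in hA.
pose m := expR (s - 8 * U * ln 2 - U / (192 * M)).
have [|||||||||c [S [W [bSW SA Sc WA mW]]]] :=
  @monochromatic_book V col R col_sym (8 * u) mu (ln 2 + 8 * eps) eps m A (fun => A).
- by rewrite -(ler_nat R) -ME.
- by rewrite natrM -ME -UE; lra.
- by rewrite natrM -UE -LamE; lra.
- by lra.
- exact: eps0.
- exact: expR_gt0.
- move=> c x xA; apply: le_trans (deg c x xA); apply: ler_wpM2r => //.
  rewrite opprD expRD expRN lnK ?posrE //.
  have := @expRN_le R (8 * eps); lra.
- apply: le_trans hA; rewrite ler_expR natrM -UE -ME -LamE.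
  apply: le_trans (large_exponent ka (lexx U)).
  have : U * (9 * M + 2 + Lam) <= U * (10 * M) by rewrite ler_pM2l //; lra.
  by lra.
- move=> c; apply: le_trans hA; rewrite -expRD ler_expR natrM -UE -ME -LamE.
  by have := overhead_bound; rewrite /s; lra.
have ta : (#|S| <= a c)%N.
  rewrite Sc -(ler_nat R) natrM -UE.
  have : k%:R <= (a c)%:R + U by rewrite UE -natrD ler_nat ka.
  by lra.
apply: (book_extend col_sym bSW SA WA ta).
(* In the pages of a book of colour c the target is a c - 8 u against a (~~ c), so
   colour c gets the smaller weight (1 - eta) / 2. *)
pose b d := if d == c then ln 2 - ln (1 - eta) else ln 2 - ln (1 + eta).
apply: (@erdos_szekeres R V col col_sym b).
  have -> : expR (- b true) + expR (- b false) = expR (- b c) + expR (- b (~~ c)).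
    by case: (c); rewrite // addrC.
  rewrite /b eqxx; have -> : (~~ c == c) = false by case: (c).
  rewrite !opprB !expRB !lnK ?posrE //; lra.
have -> : b true * (update a c (a c - #|S|)%N true)%:R +
          b false * (update a c (a c - #|S|)%N false)%:R =
    (ln 2 - ln (1 - eta)) * ((a c)%:R - 8 * U) + (ln 2 - ln (1 + eta)) * (a (~~ c))%:R.
  have -> : (a c)%:R - 8 * U = (a c - #|S|)%:R by rewrite natrB // Sc natrM UE.
  by rewrite /b /update; case: (c); rewrite //= addrC.
apply: le_trans (_ : m <= _); last by lra.
rewrite ler_expR.
apply: le_trans (unbalanced_bound c etaM ka ak) _.
by rewrite /s natrD; case: (c) => /=; lra.
Qed.

(** Here l is the number of unbalanced steps still available. Each of them gains a
factor exp (eps / 2) over halving; when none is left, the plain bound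
2^(a true + a false) applies. *)
Lemma clique_by_steps l A a : (l <= u)%N ->
  (forall c, k + l <= a c + u)%N -> (forall c, a c <= k)%N ->
  expR ((a true + a false)%:R * ln 2 - eps * l%:R / 2) <= #|A|%:R ->
  has_clique col A a.
Proof.
case: sc => ME UE LamE epsM M64 MLam uM uLam ueps klo khi.
have [M0 U0 eps0 eps_le MU] := scales_facts.
elim: l A a => [|l IH] A a lu ka ak hA.
  apply: (@erdos_szekeres R V col col_sym (fun => ln 2)).
    by rewrite expRN lnK ?posrE //; lra.
  move: hA; rewrite mulr0 mul0r subr0 natrD => hA.
  apply: le_trans (_ : #|A|%:R <= _); last by lra.
  by rewrite -mulrDr mulrC.
have kau c : (k <= a c + u)%N by apply: leq_trans (ka c); apply: leq_addr.
have lU : l.+1%:R <= U by rewrite UE ler_nat.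
have Abig : U <= #|A|%:R.
  apply: le_trans hA; apply: le_trans (expR_ge1Dx _).
  by have := large_exponent kau lU; lra.
have [/existsP[[c x] /= /andP[xA hx]]|] := boolP [exists p : bool * V,
    (p.2 \in A) && (#|nbr col p.1 p.2 :&: A|%:R < (2^-1 - eps) * #|A|%:R)]; last first.
  move=> /existsPn reg; apply: clique_in_regular => //.
    by move=> c x xA; have := reg (c, x); rewrite /= xA /= -leNgt.
  apply: le_trans hA; rewrite ler_expR.
  by have := ler_wpM2l (ltW eps0) lU; lra.
pose d := ~~ c.
have ad : (0 < a d)%N.
  rewrite -(ltr_nat R).
  have : k%:R <= (a d)%:R + U by rewrite UE -natrD ler_nat kau.
  by lra.
apply: (has_clique_step col_sym xA ad); apply: IH.
- exact: ltnW.
- move=> c'; rewrite /update; case: eqVneq => [_|_].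
    by rewrite -ltnS -addnS -addSn prednK.
  by apply: leq_trans (ka c'); rewrite leq_add2l.
- by move=> c'; rewrite /update; case: eqVneq => // _; apply: leq_trans (ak d); apply: leq_pred.
have hd : (1 + eps) / 2 * #|A|%:R <= #|nbr col d x :&: A|%:R.
  have : #|A|%:R <= #|nbr col c x :&: A|%:R + #|nbr col d x :&: A|%:R + 1 :> R.
    rewrite -natrD natr1 ler_nat; have := card_le_nbr col A x; rewrite ![A :&: _]setIC /d.
    by case: (c) => //=; rewrite addnC.
  have : 1 <= eps / 2 * #|A|%:R.
    apply: le_trans (_ : eps / 2 * U <= _); last by apply: ler_wpM2l => //; lra.
    have := ler_wpM2l (ltW eps0) ueps; rewrite mulrCA mulfV ?gt_eqF //; lra.
  by lra.
apply: le_trans hd.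
have e1 : expR (eps / 2) <= 1 + eps.
  by have := @expR_le1D2x R (eps / 2); lra.
have -> : (update a d (a d).-1 true + update a d (a d).-1 false)%:R * ln 2 - eps * l%:R / 2
   = - ln 2 + eps / 2 + ((a true + a false)%:R * ln 2 - eps * l.+1%:R / 2).
  have : (a d)%:R = (a d).-1%:R + 1 :> R by rewrite natr1 prednK.
  by rewrite /update -natr1 !natrD; case: (d) => /= ->; lra.
rewrite expRD; apply: ler_pM => //; rewrite ?expR_ge0 //.
by rewrite expRD expRN lnK ?posrE //; lra.
Qed.

End Improvement.

(** * The diagonal Ramsey number *)

Lemma ramsey_le k n :
  (forall col : rel 'I_n, symmetric col ->
     has_clique col [set: 'I_n] (fun => k)) ->
  (ramsey k <= n)%N.
Proof.
move=> H; rewrite /ramsey; case: ex_minnP => r _; apply; apply/forallP => f.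
pose col x y := if insub [set x; y] is Some e then f e else false.
have [|c [S [_ Sk cS]]] := H col; first by move=> x y; rewrite /col setUC.
apply/existsP; exists S; rewrite Sk eqxx /=; apply/existsP; exists c.
apply/forallP => e; apply/implyP.
have /cards2P [x [y [xy eE]]] := valP e.
rewrite eE subUset !sub1set => /andP[xS yS]; apply/eqP.
by rewrite -(cS x y xS yS xy) /col -eE valK.
Qed.

(** With C = 128 * 256, M = C (z + 2) turns the claim into C M <= exp z, which
follows from z^2 / 2 <= exp z for z >= 2 C^2 + 2. *)
Lemma exists_scale (R : realType) : exists mu : nat,
  64 <= mu%:R :> R /\ 128 * 256 * (2 - ln (128 * 256 * mu%:R)^-1) <= mu%:R :> R.
Proof.
have [C CE] : exists C : R, C = 128 * 256 by exists (128 * 256).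
have C1 : 128 <= C by lra.
have B0 : 0 <= C * (2 * C ^+ 2 + 4) by rewrite mulr_ge0 ?addr_ge0 ?mulr_ge0 ?sqr_ge0 //; lra.
exists (Num.bound (C * (2 * C ^+ 2 + 4))); have := archi_boundP B0.
move: (Num.bound _)%:R => M MB; rewrite -CE.
have C0 : 0 < C by lra.
have M64 : 64 <= M by nra.
split=> //.
have CM : 0 < C * M by rewrite mulr_gt0 //; lra.
rewrite lnV ?posrE // opprK -ler_pdivlMl //.
have [z zE] : exists z, z = C^-1 * M - 2 by exists (C^-1 * M - 2).
have ME : M = C * (z + 2) by rewrite zE; field; lra.
have zC : 2 * C ^+ 2 + 2 <= z by rewrite ME ltr_pM2l // in MB; lra.
suff : ln (C * M) <= z by rewrite zE; lra.
rewrite -[leRHS]expRK ler_ln ?posrE ?expR_gt0 //.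
have z0 : 0 <= z by have := sqr_ge0 C; lra.
have := @expR_ge1Dxn R z 1 z0; rewrite (_ : 2`!%:R = 2 :> R) // => h; apply: le_trans h.
have -> : C * M = C ^+ 2 * (z + 2) by rewrite ME; ring.
have : (2 * C ^+ 2 + 2) * z <= z * z by apply: ler_wpM2r.
by have := sqr_ge0 C; rewrite -expr2; lra.
Qed.

Theorem theorem1p1 (R : realType) :
  exists2 eps : R, 0 < eps &
    exists k0 : nat, forall k : nat, (k0 <= k)%N ->
      (ramsey k)%:R <= (4 - eps) ^+ k.
Proof.
have [mu [M64 MLam]] := exists_scale R.
(* The parameters are known by equations only, so that linear arithmetic takes them
   as atoms. *)
have [M ME] : exists M : R, M = mu%:R by exists mu%:R.
rewrite -ME in M64 MLam.
have M0 : 0 < M by lra.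
have [eps epsE] : exists eps : R, eps = (128 * 256 * M)^-1 by exists (128 * 256 * M)^-1.
rewrite -epsE in MLam.
have eps0 : 0 < eps by rewrite epsE invr_gt0; lra.
have epsM : 128 * 256 * (eps * M) = 1 by rewrite epsE; field; lra.
have [Lam LamE] : exists Lam, Lam = 2 - ln eps by exists (2 - ln eps).
rewrite -LamE in MLam.
have [D DE] : exists D : nat, D%:R = 512 * M by exists (512 * mu)%N; rewrite natrM ME.
have D0 : (0 < D)%N by rewrite -(ltr_nat R) DE; lra.
have [nu nuE] : exists nu, nu * (512 * M + 1) = eps / 4.
  by exists (eps / 4 / (512 * M + 1)); field; lra.
have nu0 : 0 < nu by rewrite -(@pmulr_lgt0 _ (512 * M + 1)) ?nuE ?divr_gt0 //; lra.
exists (4 - 4 * expR (- nu)).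
  by have := expR_lt1 (- nu); rewrite oppr_lt0 nu0; lra.
have E0 : 0 < expR Lam by apply: expR_gt0.
have V0 : 0 < 4 / eps by rewrite divr_gt0.
have M2 : 0 <= M ^+ 2 by apply: sqr_ge0.
pose u0 := Num.bound (512 * M + M ^+ 2 + 100 * 100 * expR Lam + 4 / eps).
have u0B : 512 * M + M ^+ 2 + 100 * 100 * expR Lam + 4 / eps < u0%:R.
  by apply: archi_boundP; lra.
(* D = 512 mu, and u is the largest integer with D u <= k; as u >= D, also k <= D u + u. *)
exists (u0 * D)%N => k kk0.
have [u uE] : exists u : nat, u = (k %/ D)%N by exists (k %/ D)%N.
have uB : u0%:R <= u%:R :> R by rewrite ler_nat uE leq_divRL.
have klo : 512 * M * u%:R <= k%:R.
  by rewrite -DE -natrM ler_nat mulnC uE leq_divM.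
have khi : k%:R <= 512 * M * u%:R + u%:R.
  have : k%:R <= (u.+1 * D)%:R :> R by rewrite ler_nat ltnW // -ltn_divLR // uE.
  by rewrite natrM -natr1 DE; lra.
have [U UE] : exists U : R, U = u%:R by exists u%:R.
rewrite -UE in uB klo khi.
have sc : scales mu u k M U eps Lam.
  have : 2 / eps <= 4 / eps by rewrite ler_pM2r ?invr_gt0 //; lra.
  by split=> //; lra.
have epsU : 1 <= eps * U / 4.
  have : 4 / eps <= U by lra.
  by rewrite ler_pdivrMr // mulrC; lra.
rewrite opprB addrC subrK.
set x := _ ^+ k.
have xE : x = expR (2 * k%:R * ln 2 - nu * k%:R).
  have -> : 2 * k%:R * ln 2 - nu * k%:R = k%:R * (ln 2 + ln 2 - nu) by ring.
  rewrite /x expRM_natl !expRD lnK ?posrE //; congr (_ ^+ k); lra.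
have x0 : 0 <= x by rewrite xE expR_ge0.
apply: le_trans (_ : (Num.truncn x)%:R <= _); last by rewrite truncn_le.
rewrite ler_nat; apply: ramsey_le => col col_sym.
apply: (clique_by_steps sc col_sym (leqnn u)) => //.
rewrite cardsT card_ord -UE natrD.
have /andP[_] := truncn_itv x0; rewrite -natr1 => xn.
suff : expR ((k%:R + k%:R) * ln 2 - eps * U / 2) + 1 <= x by lra.
set y := (k%:R + k%:R) * ln 2 - eps * U / 2.
have y0 : 0 <= y.
  have : (k%:R + k%:R) * 2^-1 <= (k%:R + k%:R) * ln 2 :> R.
    by apply: ler_wpM2l (ln2_ge R); apply: addr_ge0.
  have U0 : 0 <= U by rewrite UE.
  have MU : 64 * U <= M * U by apply: ler_wpM2r.
  have : eps * U <= 1 * U.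
    by apply: ler_wpM2r => //; have := ler_wpM2l (ltW eps0) M64; lra.
  by rewrite /y; lra.
have xy : expR (y + 1) <= x.
  rewrite xE ler_expR /y.
  have : nu * k%:R <= nu * (512 * M * U + U) by apply: ler_wpM2l => //; apply: ltW.
  have -> : nu * (512 * M * U + U) = nu * (512 * M + 1) * U by ring.
  by rewrite nuE; lra.
have ey : 1 <= expR y by apply: le_trans (expR_ge1Dx y); rewrite lerDl.
apply: le_trans xy; rewrite (expRD y 1).
apply: le_trans (_ : expR y * 2 <= _); first by move: (expR y) ey => z; lra.
by apply: ler_wpM2l (expR1_ge2 R); apply: expR_ge0.
Qed.
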